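(* Let $n\ge 3$ and let $v=(v_1,\ldots,v_n)^\top\in\mathbb{C}^n$ satisfy $v_{i+1}\neq v_i$ for all $i=1,\ldots,n$ (indices cyclic, $v_{n+1}=v_1$). Put $\widetilde w_i=\frac{v_i}{v_{i+1}-v_i}$ for $i=1,\ldots,n$ and $\widetilde M=M(\widetilde w)$. Then $v$ is an eigenvector of $\widetilde M$ with eigenvalue $2$ and $(1,\ldots,1)^\top$ is an eigenvector of $\widetilde M$ with eigenvalue $1$; let $1+\mu_2,\ldots,1+\mu_{n-1}$ denote the remaining $n-2$ eigenvalues of $\widetilde M$, so that the eigenvalues of $\widetilde M$, listed with algebraic multiplicity, are $2,\,1,\,1+\mu_2,\ldots,1+\mu_{n-1}$. For $\mu\in\mathbb{C}$ let $\Lambda_\mu=\{\lambda\in\mathbb{C} : |1+\lambda|^2>|1+\lambda\mu|^2\}$. Assume that $\bigcap_{i=2}^{n-1}\Lambda_{\mu_i}\neq\emptyset$. Then there exist weights $w=(w_1,\ldots,w_n)\in\mathbb{C}^n$ such that $v$ is the limit polygon of the transformation matrix $M(w)$.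
   Context: A polygon ($n$-gon) is a vector in $\mathbb{C}^n$ whose entries are its vertices. For weights $w=(w_1,\ldots,w_n)\in\mathbb{C}^n$, the transformation matrix $M(w)\in\mathbb{C}^{n\times n}$ is defined by $(M(w)z)_i=(1-w_i)z_i+w_i z_{i+1}$ for $i=1,\ldots,n$, with cyclic indices $z_{n+1}=z_1$; that is, row $i$ has entry $1-w_i$ in column $i$, entry $w_i$ in column $i+1$ (column $1$ if $i=n$), and zeros elsewhere. A polygon $v\in\mathbb{C}^n$ is called the limit polygon of a matrix $M=M(w)$ if the sequence $z^{(k)}=M^k z^{(0)}$ converges to $v$ in shape, i.e. up to translation and complex scaling, for generic initial polygons. Precisely: there is a proper linear subspace $U\subsetneq\mathbb{C}^n$ such that for every $z^{(0)}\in\mathbb{C}^n\setminus U$ there are sequences $a_k\in\mathbb{C}\setminus\{0\}$ and $b_k\in\mathbb{C}$ with $a_k M^k z^{(0)}+b_k(1,\ldots,1)^\top\to v$ as $k\to\infty$. *)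

(* Defs.v *)
From HB Require Import structures.
From mathcomp Require Import all_boot all_order all_algebra.
From mathcomp Require Import all_classical all_reals all_analysis.
From mathcomp Require Export complex.

Set Implicit Arguments.
Unset Strict Implicit.
Unset Printing Implicit Defensive.

Import Order.TTheory GRing.Theory Num.Theory.
Import numFieldNormedType.Exports.

Local Open Scope ring_scope.
Local Open Scope classical_set_scope.

(* The topology of R[i] is the one induced by the complex modulus; matrices
   over R[i] then carry the library's max-norm topology. *)
#[non_forgetful_inheritance]
HB.instance Definition _ (R : rcfType) := NormedModule.copy R[i] R[i]^o.

(* Vertices are indexed by 0, ..., n - 1, and [ordS] is the cyclic successor,
   so that (transf_mx w *m z)_i = (1 - w_i) z_i + w_i z_(i+1). *)
Definition transf_mx (R : realType) (n : nat) (w : 'cV[R[i]]_n) : 'M[R[i]]_n :=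
  \matrix_(i, j)
    ((1 - w i 0) * (j == i)%:R + w i 0 * (j == ordS i)%:R).

Definition weights_of (R : realType) (n : nat) (v : 'cV[R[i]]_n) :
    'cV[R[i]]_n :=
  \col_i (v i 0 / (v (ordS i) 0 - v i 0)).

(* The library's [eigenspace] is about row vectors; polygons are columns. *)
Definition eigenvector (R : realType) (n : nat) (A : 'M[R[i]]_n) (a : R[i])
    (u : 'cV[R[i]]_n) : Prop :=
  u != 0 /\ A *m u = a *: u.

Definition limit_polygon (R : realType) (n : nat) (M : 'M[R[i]]_n)
    (v : 'cV[R[i]]_n) : Prop :=
  exists2 U : {vspace 'cV[R[i]]_n}, U != fullv &
    forall z0 : 'cV[R[i]]_n, z0 \notin U ->
      exists (a b : nat -> R[i]), (forall k, a k != 0) /\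
        (fun k => a k *: (M ^+ k *m z0) + b k *: const_mx 1) @ \oo --> v.

(* mu is used at the indices 2, ..., n - 1 only. *)
Definition remaining_eigenvalues (R : realType) (n : nat) (A : 'M[R[i]]_n)
    (mu : nat -> R[i]) : Prop :=
  char_poly A =
    ('X - 2%:P) * ('X - 1%:P) * \prod_(2 <= i < n) ('X - (1 + mu i)%:P).

Definition Lambda (R : realType) (mu : R[i]) : set R[i] :=
  [set l | `|1 + l * mu| ^+ 2 < `|1 + l| ^+ 2].

(* Main.v *)
Require Import Defs.
From mathcomp Require Import all_boot all_order all_algebra.
From mathcomp Require Import all_classical all_reals all_analysis.
From mathcomp Require Import ring lra zify.
Import numFieldNormedType.Exports.
Import Order.TTheory GRing.Theory Num.Theory.
Local Open Scope ring_scope.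
Local Open Scope classical_set_scope.
Local Open Scope complex_scope.

(* Take w = lam * w~ with lam in the intersection of the Lambda's, so that
   M(w) = 1 + lam (M~ - 1) has eigenvalues rho = 1 + lam (at v), 1 (at the
   constant polygon) and 1 + lam mu_i, with |1 + lam mu_i| < |rho|.  In
   particular no mu_i is 1, so 2 is a simple eigenvalue of M~ and a polynomial
   in M~ projects onto the line spanned by v; U is the kernel of this projection
   E.  On (1 - E) z the product (M~ - 1) prod_i (M~ - (1 + mu_i)) vanishes, and
   rho^-k M(w)^k tends to 0 there modulo constants: peeling off one factor at a
   time, the iterates satisfy e_(k+1) = r e_k + f_k with |r| < 1 and f -> 0. *)

(** * Sequences driven to zero by a contraction *)

Lemma cvg0_contraction_real (R : realType) (q : R) (a f : nat -> R) :
  0 <= q < 1 -> (forall k, 0 <= a k) ->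
  (forall k, a k.+1 <= q * a k + f k) ->
  f @ \oo --> 0 -> a @ \oo --> 0.
Proof.
move=> /andP[q0 q1] a0 af f0.
apply/cvgrPdist_lt => e e0.
have d0 : 0 < e / 2 * (1 - q) by rewrite mulr_gt0 ?divr_gt0 ?subr_gt0.
move/cvgrPdist_lt: (f0) => /(_ _ d0) [N _ HN].
have fN k : (N <= k)%N -> f k <= e / 2 * (1 - q).
  move=> /HN /=; rewrite sub0r normrN => /ltW; exact: le_trans (ler_norm _).
(* The bound is inductive because [q * (e / 2) + e / 2 * (1 - q) = e / 2]; this dictates the
   threshold in [d0]. *)
have aN j : a (j + N)%N <= e / 2 + q ^+ j * a N.
  elim: j => [|j IH]; first by rewrite expr0 mul1r add0n lerDr divr_ge0 // ltW.
  apply: le_trans (af _) _.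
  apply: le_trans (lerD (ler_wpM2l q0 IH) (fN _ (leq_addl _ _))) _.
  by rewrite exprS mulrDr mulrBr mulr1 -mulrA [q * (e / 2)]mulrC; lra.
(* [a N] may vanish, so [a N + 1] serves as the denominator. *)
have aN1 : 0 < a N + 1 by rewrite ltr_wpDl.
have := @cvg_expr R q.
rewrite ger0_norm // => /(_ q1) /cvgrPdist_lt /(_ (e / 2 / (a N + 1))).
rewrite !divr_gt0 // => /(_ isT) [J _ HJ].
exists (J + N)%N => // k /= Hk.
have kN : (N <= k)%N by apply: leq_trans Hk; rewrite leq_addl.
rewrite sub0r normrN ger0_norm // -(subnK kN).
apply: le_lt_trans (aN _) _.
rewrite [X in _ < X](splitr e) ltrD2l.
have := HJ (k - N)%N; rewrite /= leq_subRL // [(N + _)%N]addnC. move=> /(_ Hk).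
rewrite sub0r normrN ger0_norm ?exprn_ge0 // ltr_pdivlMr //.
by apply: le_lt_trans; rewrite ler_wpM2l ?exprn_ge0 // lerDl.
Qed.

Lemma norm_Re (R : realType) (V : normedModType R[i]) (x : V) :
  `|x| = (complex.Re `|x|)%:C.
Proof. by rewrite RRe_real // ger0_real. Qed.

(** Over [R[i]] both the norm and the radii of balls are complex numbers. Positive ones are real, so
    real parts lose nothing and real estimates become available. *)
Lemma cvg0_Re_norm (R : realType) (V : normedModType R[i]) (x : nat -> V) :
  x @ \oo --> 0 <-> (fun k => complex.Re `|x k|) @ \oo --> (0 : R).
Proof.
have Re_ge0 y : 0 <= complex.Re `|y : V|.
  by rewrite -lecR -norm_Re normr_ge0.
split=> /cvgrPdist_lt h; apply/cvgrPdist_lt => e e0.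
- have eC : 0 < e%:C by rewrite (ltcR 0).
  have [N _ HN] := h _ eC; exists N => // k /HN /=.
  by rewrite !sub0r !normrN (ger0_norm (Re_ge0 _)) -ltcR -norm_Re.
- have eE : e = (complex.Re e)%:C by rewrite RRe_real // gtr0_real.
  have eR : 0 < complex.Re e by rewrite -(ltcR 0) -eE.
  have [N _ HN] := h _ eR; exists N => // k /HN /=.
  by rewrite !sub0r !normrN (ger0_norm (Re_ge0 _)) -ltcR -norm_Re -eE.
Qed.

Lemma cvg0_contraction (R : realType) (V : normedModType R[i]) (r : R[i])
    (x f : nat -> V) :
  `|r| < 1 -> (forall k, x k.+1 = r *: x k + f k) ->
  f @ \oo --> 0 -> x @ \oo --> 0.
Proof.
move=> r1 xf /cvg0_Re_norm f0; apply/cvg0_Re_norm.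
have rE : `|r| = (complex.Re `|r|)%:C by rewrite RRe_real // ger0_real.
apply: (@cvg0_contraction_real _ (complex.Re `|r|)) f0.
- by rewrite -lecR -ltcR -rE normr_ge0.
- by move=> k; rewrite -lecR -norm_Re normr_ge0.
- move=> k; rewrite -lecR rmorphD rmorphM /= -rE -!norm_Re xf.
  by rewrite -normrZ ler_normD.
Qed.

(** * Characteristic polynomials and invariant subspaces *)

Lemma char_poly_tr (F : comNzRingType) (n : nat) (A : 'M[F]_n) :
  char_poly A^T = char_poly A.
Proof.
rewrite /char_poly -det_tr /char_poly_mx raddfB /= tr_scalar_mx map_trmx.
by rewrite trmxK.
Qed.

(** The sizes [m] and [n] are kept apart because a completed basis has [m + \rank _] rows, which
    equals the dimension only propositionally; the two rank hypotheses force equality. *)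
Lemma char_poly_conj (F : fieldType) (m n : nat) (P : 'M[F]_(m, n))
    (A : 'M[F]_n) (C : 'M[F]_m) :
  row_free P -> row_full P -> P *m A = C *m P -> char_poly C = char_poly A.
Proof.
rewrite /row_free /row_full => /eqP rm /eqP rn.
have e : m = n by rewrite -rm.
subst m => PA.
have Pu : P \in unitmx by rewrite -row_full_unit /row_full rn.
have -> : C = P *m A *m invmx P by rewrite PA mulmxK.
have PuX : map_mx polyC P *m map_mx polyC (invmx P) = 1%:M.
  by rewrite -map_mxM mulmxV // map_mx1.
have PAE : char_poly_mx (P *m A *m invmx P) =
    map_mx polyC P *m char_poly_mx A *m map_mx polyC (invmx P).
  rewrite /char_poly_mx mulmxBr mulmxBl !map_mxM /=; congr (_ - _).
  by rewrite scalar_mxC -mulmxA PuX mulmx1.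
by rewrite /char_poly PAE !det_mulmx mulrAC -det_mulmx PuX det1 mul1r.
Qed.

(** Complete the rows of [V] to a basis [P]. In this basis [A] becomes block lower triangular with
    upper left block [C], and the determinant factors. *)
Lemma char_poly_invariant_dvd (F : fieldType) (m n : nat) (V : 'M[F]_(m, n))
    (A : 'M[F]_n) (C : 'M[F]_m) :
  row_free V -> V *m A = C *m V -> (char_poly C %| char_poly A)%R.
Proof.
move=> Vfree VA.
pose W := row_base (V^C)%MS; pose P := col_mx V W.
have Pfull : row_full P.
  rewrite -sub1mx -addsmxE.
  apply: submx_trans (addsmxS (submx_refl V) _); last first.
    by rewrite (eq_row_base (V^C)%MS).
  by rewrite sub1mx addsmx_compl_full.
have Pfree : row_free P.
  rewrite /row_free (eqP Pfull) mxrank_compl (eqP Vfree) subnKC //.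
  by rewrite -(eqP Vfree) rank_leq_col.
pose L := P *m A *m pinvmx P.
have PA : P *m A = L *m P by rewrite mulmxKpV // submx_full.
have UL : usubmx L = row_mx C 0.
  apply: (row_free_inj Pfree).
  rewrite mul_usub_mx mul_row_col mul0mx addr0 -VA -PA.
  by rewrite mul_col_mx col_mxKu.
rewrite -(char_poly_conj _ _ _ _ _ _ Pfree Pfull PA).
rewrite -[L]submxK /ulsubmx /ursubmx UL row_mxKl row_mxKr.
rewrite /char_poly /char_poly_mx map_block_mx map_mx0 scalar_mx_block.
by rewrite opp_block_mx add_block_mx oppr0 addr0 det_lblock dvdp_mulr.
Qed.

(** The independent eigenvectors span an invariant plane on which [A] acts as the diagonal matrix of
    [a] and [b]. The case [a = b] is allowed: it turns a second eigenvector into a double root. *)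
Lemma char_poly_eigen2_dvd (F : fieldType) (n : nat) (A : 'M[F]_n) (a b : F)
    (x y : 'cV[F]_n) :
  A *m x = a *: x -> A *m y = b *: y -> x != 0 ->
  (forall c, y != c *: x) ->
  (('X - a%:P) * ('X - b%:P) %| char_poly A).
Proof.
move=> Ax Ay x0 yx.
pose V := col_mx x^T y^T.
pose C : 'M[F]_(1 + 1) := block_mx a%:M 0 0 b%:M.
have VA : V *m A^T = C *m V.
  rewrite mul_col_mx mul_block_col -!trmx_mul Ax Ay !mul0mx addr0 add0r.
  by rewrite !mul_scalar_mx !linearZ.
have Vfree : row_free V.
  apply: inj_row_free => u.
  rewrite -[u]hsubmxK mul_row_col [lsubmx u]mx11_scalar [rsubmx u]mx11_scalar.
  rewrite !mul_scalar_mx => /(congr1 trmx).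
  rewrite linearD !linearZ /= !trmxK trmx0 => H.
  set s := lsubmx u 0 0 in H *; set t := rsubmx u 0 0 in H *.
  have t0 : t = 0.
    apply/eqP; apply: contraT => t0.
    have := yx (- (t^-1 * s)); rewrite scaleNr -scalerA -addr_eq0.
    have -> : y = t^-1 *: (t *: y) by rewrite scalerA mulVf // scale1r.
    by rewrite addrC -scalerDr H scaler0 eqxx.
  have s0 : s = 0.
    move: H; rewrite t0 scale0r addr0 => /eqP.
    by rewrite scaler_eq0 (negPf x0) orbF => /eqP.
  by rewrite s0 t0 !raddf0 row_mx0.
have := char_poly_invariant_dvd _ _ _ _ _ _ Vfree VA.
rewrite char_poly_tr; congr (_ %| _).
rewrite /char_poly /char_poly_mx map_block_mx !map_mx0 !map_scalar_mx.
rewrite scalar_mx_block opp_block_mx add_block_mx oppr0 addr0 det_lblock.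
by rewrite -!raddfB /= !det_scalar1.
Qed.

(** * Convergence of the normalised iterates *)

(** Induction on [s]: the vector [(A - a) y] is annihilated by the shorter product, and [T y]
    differs from a multiple of [y] by [lam] times that vector. *)
Lemma iterates_cvg0_mod (R : realType) (n : nat) (A : 'M[R[i]]_n.+1)
    (u : 'cV[R[i]]_n.+1) (lam : R[i]) (s : seq R[i]) (y : 'cV[R[i]]_n.+1) :
  let T := 1%:M + lam *: (A - 1%:M) in
  1 + lam != 0 ->
  (forall x, A *m x = x -> (exists c, x = c *: u) \/ 1 < `|1 + lam|) ->
  (forall x, x \in s -> `|1 + lam * (x - 1)| < `|1 + lam|) ->
  horner_mx A (('X - 1%:P) * \prod_(x <- s) ('X - x%:P)) *m y = 0 ->
  exists b : nat -> R[i],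
    (fun k => (1 + lam) ^- k *: (T ^+ k *m y) + b k *: u) @ \oo -->
      (0 : 'cV[R[i]]_n.+1).
Proof.
move=> T rho0 ker1; set rho := 1 + lam.
have TE (x : 'cV_n.+1) a :
    T *m x = (1 + lam * (a - 1)) *: x + lam *: (horner_mx A ('X - a%:P) *m x).
  rewrite /T rmorphB /= horner_mx_X horner_mx_C mulmxDl -scalemxAl !mulmxBl.
  rewrite !mul1mx mul_scalar_mx.
  by apply/colP => i; rewrite !mxE; ring.
elim: s y => [|a s IH] y hs.
  rewrite big_nil mulr1 => y0.
  have Ty : T *m y = y.
    by rewrite (TE _ 1) y0 scaler0 addr0 subrr mulr0 addr0 scale1r.
  have Tky k : T ^+ k *m y = y.
    by elim: k => [|k IH]; rewrite ?expr0 ?mul1mx // exprSr -mulmxA Ty.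
  have Ay : A *m y = y.
    move: y0; rewrite rmorphB /= horner_mx_X horner_mx_C mulmxBl mul1mx.
    by move/eqP; rewrite subr_eq0 => /eqP.
  (* Here [T] fixes [y]: either [y] is a multiple of [u] and [b] cancels it exactly, or [1 < |rho|]
     and the factor [rho ^- k] kills it. *)
  have [[c yE]|rho1] := ker1 _ Ay.
    exists (fun k => - (rho ^- k * c)).
    rewrite (_ : (fun k => _) = fun=> 0); first exact: cvg_cst.
    by apply/funext => k; rewrite Tky yE scaleNr scalerA subrr.
  exists (fun=> 0).
  apply: (@cvg0_contraction _ _ rho^-1 _ (fun=> 0)); last exact: cvg_cst.
    by rewrite normfV invf_lt1 // (lt_trans ltr01).
  by move=> k; rewrite !scale0r !addr0 !Tky scalerA exprS invfM mulrC.
rewrite big_cons mulrCA [_ * (_ * _)]mulrC rmorphM /=.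
rewrite -mulmxE -mulmxA => hy.
have hs' x : x \in s -> `|1 + lam * (x - 1)| < `|1 + lam|.
  by move=> xs; apply: hs; rewrite inE xs orbT.
have [b' hb'] := IH _ hs' hy.
set y' := horner_mx A ('X - a%:P) *m y in hb' *.
pose r := (1 + lam * (a - 1)) / rho.
pose t := lam / rho.
(* The translations obey the same recurrence as the iterates, so the corrected sequence is again a
   contraction with forcing term tending to 0. The initial value 0 is arbitrary. *)
pose b := fix b k := if k is k'.+1 then r * b k' + t * b' k' else 0.
exists b.
apply: (@cvg0_contraction _ _ r _
  (fun k => t *: (rho ^- k *: (T ^+ k *m y') + b' k *: u))).
- by rewrite /r normf_div ltr_pdivrMr ?normr_gt0 // mul1r hs // mem_head.
- move=> k /=; rewrite [T ^+ _]exprSr -mulmxA (TE _ a) -/y' mulmxDr -!scalemxAr.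
  rewrite exprSr invfM /r /t.
  by apply/colP => i; rewrite !mxE; ring.
- by rewrite -(scaler0 _ t); apply: cvgZ => //; exact: cvg_cst.
Qed.

(** The modulus of [1 + lam] may be below 1. The eigenvalue 1 then dominates, but along [const_mx 1]
    it contributes only a translation. *)
Lemma limit_polygon_dominant (R : realType) (n : nat) (A : 'M[R[i]]_n.+1)
    (v : 'cV[R[i]]_n.+1) (lam : R[i]) (s : seq R[i]) :
  1 + lam != 0 -> v != 0 -> A *m v = 2 *: v ->
  A *m const_mx 1 = (const_mx 1 : 'cV_n.+1) ->
  char_poly A = ('X - 2%:P) * ('X - 1%:P) * \prod_(x <- s) ('X - x%:P) ->
  (forall x, x \in s -> `|1 + lam * (x - 1)| < `|1 + lam|) ->
  limit_polygon (1%:M + lam *: (A - 1%:M)) v.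
Proof.
set u : 'cV_n.+1 := const_mx 1 => rho0 v0 Av Au pA hs.
have u0 : u != 0.
  by apply/eqP => /colP/(_ 0) /eqP; rewrite !mxE oner_eq0.
have eig a x : A *m x = a *: x -> horner_mx A ('X - a%:P) *m x = 0.
  move=> Ax; rewrite rmorphB /= horner_mx_X horner_mx_C mulmxBl.
  by rewrite mul_scalar_mx Ax subrr.
have eigV a x : horner_mx A ('X - a%:P) *m x = 0 -> A *m x = a *: x.
  rewrite rmorphB /= horner_mx_X horner_mx_C mulmxBl mul_scalar_mx.
  by move/eqP; rewrite subr_eq0 => /eqP.
pose q := \prod_(x <- s) ('X - x%:P).
pose p := ('X - 1%:P) * q.
(* If 2 were in [s], [hs] would give [|1 + lam| < |1 + lam|]. *)
have p2 : ~~ root p 2.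
  rewrite rootM root_XsubC root_prod_XsubC negb_or; apply/andP; split.
    by rewrite -subr_eq0 (_ : 2 - 1 = 1) ?oner_eq0 //; ring.
  by apply/negP => /hs; rewrite (_ : lam * (2 - 1) = lam) ?ltxx //; ring.
have ker2 x : A *m x = 2 *: x -> exists c, x = c *: v.
  move=> Ax; apply: contrapT => xv.
  have : ('X - 2%:P) * ('X - 2%:P) %| char_poly A.
    apply: (char_poly_eigen2_dvd _ _ _ _ _ _ _ Av Ax v0) => c.
    by apply/eqP => xE; apply: xv; exists c.
  rewrite pA -mulrA dvdp_mul2l ?polyXsubC_eq0 // dvdp_XsubCl.
  by rewrite -/q -/p (negPf p2).
(* If the eigenvalue 1 is not simple, it occurs in s, which forces 1 < |rho|. *)
have ker1 x : A *m x = x -> (exists c, x = c *: u) \/ 1 < `|1 + lam|.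
  move=> Ax; have [|xu] := pselect (exists c, x = c *: u); [by left | right].
  have : ('X - 1%:P) * ('X - 1%:P) %| char_poly A.
    apply: (char_poly_eigen2_dvd _ _ _ _ _ u x _ _ u0) => [||c];
      rewrite ?scale1r //.
    by apply/eqP => xE; apply: xu; exists c.
  rewrite pA -mulrA mulrCA dvdp_mul2l ?polyXsubC_eq0 // dvdp_XsubCl.
  rewrite rootM root_XsubC root_prod_XsubC => /orP[/eqP|/hs].
    move=> /eqP; rewrite -subr_eq0 (_ : 1 - 2 = -1) ?oppr_eq0 ?oner_eq0 //.
    by ring.
  by rewrite subrr mulr0 addr0 normr1.
pose E := horner_mx A (p.[2]^-1 *: p).
have CH r : horner_mx A (r * (('X - 2%:P) * p)) = 0.
  by rewrite [_ * p]mulrA -pA rmorphM /= Cayley_Hamilton mulr0.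
(* The scaled [p] takes the value 1 at 2, so [1 - E] has the factor [A - 2]; multiplied by [p(A)] it
   vanishes by Cayley-Hamilton. *)
have [r pE] : exists r, 1 - p.[2]^-1 *: p = r * ('X - 2%:P).
  apply/factor_theorem; rewrite /root hornerD hornerN hornerZ -polyC1 hornerC.
  by rewrite mulVf ?subrr.
have y0 (z : 'cV_n.+1) : horner_mx A p *m (z - E *m z) = 0.
  have -> : z - E *m z = horner_mx A (1 - p.[2]^-1 *: p) *m z.
    by rewrite rmorphB /= rmorph1 mulmxBl mul1mx.
  by rewrite mulmxA mulmxE -rmorphM /= pE mulrCA [p * _]mulrC CH mul0mx.
have Ev : E *m v = v.
  apply/eqP; rewrite eq_sym -subr_eq0.
  have -> : v - E *m v = horner_mx A (1 - p.[2]^-1 *: p) *m v.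
    by rewrite rmorphB /= rmorph1 mulmxBl mul1mx.
  by rewrite pE rmorphM /= -mulmxE -mulmxA eig // mulmx0.
have AE (z : 'cV_n.+1) : A *m (E *m z) = 2 *: (E *m z).
  apply: eigV; rewrite mulmxA mulmxE -rmorphM /= -mul_polyC mulrCA CH.
  by rewrite mul0mx.
exists (lker (linfun (mulmx E))).
  apply/eqP => Ufull.
  have : v \in lker (linfun (mulmx E)) by rewrite Ufull memvf.
  by rewrite memv_ker lfunE /= Ev (negPf v0).
move=> z; rewrite memv_ker lfunE /= => Ez0.
have [c Ez] := ker2 _ (AE z).
have c0 : c != 0 by apply: contraNneq Ez0 => c0; rewrite Ez c0 scale0r.
have [b hb] := iterates_cvg0_mod _ _ _ _ _ _ _ rho0 ker1 hs (y0 z).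
set T := 1%:M + _ in hb *; set rho := 1 + lam in hb rho0.
exists (fun k => c^-1 * rho ^- k), (fun k => c^-1 * b k); split.
  by move=> k; rewrite mulf_neq0 ?invr_eq0 ?expf_neq0.
have Tv : T *m v = rho *: v.
  rewrite mulmxDl -scalemxAl mulmxBl mul1mx Av.
  by apply/colP => i; rewrite !mxE /rho; ring.
have Tkv k : T ^+ k *m v = rho ^+ k *: v.
  elim: k => [|k IH]; first by rewrite !expr0 mul1mx scale1r.
  by rewrite !exprSr -mulmxE -mulmxA Tv -scalemxAr IH scalerA mulrC.
(* Split [z] as [E z + (z - E z)]. Since [E z = c v] is scaled by [rho] at each step, the first
   summand contributes exactly [v]. *)
rewrite (_ : (fun k => _) = fun k => v +
    c^-1 *: (rho ^- k *: (T ^+ k *m (z - E *m z)) + b k *: u)).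
  rewrite -[X in _ --> X]addr0; apply: cvgD; first exact: cvg_cst.
  rewrite -[X in _ --> X](scaler0 _ c^-1); apply: cvgZ hb; exact: cvg_cst.
apply/funext => k; rewrite Ez mulmxBr -!scalemxAr Tkv.
move: (T ^+ k *m z) (b k) (expf_neq0 k rho0) => x d rhok0.
apply/colP => i; rewrite !mxE.
by field; rewrite rhok0 c0.
Qed.

(** * Transformation matrices and the choice of weights *)

Lemma transf_mx_mul (R : realType) (n : nat) (w z : 'cV[R[i]]_n) (i : 'I_n) :
  (transf_mx w *m z) i 0 = (1 - w i 0) * z i 0 + w i 0 * z (ordS i) 0.
Proof.
rewrite mxE.
under eq_bigr => j _ do rewrite mxE mulrDl -!mulrA.
rewrite big_split -!mulr_sumr /=; congr (_ * _ + _ * _).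
  rewrite (bigD1 i) //= eqxx mul1r big1 ?addr0 // => j /negPf ->.
  by rewrite mul0r.
rewrite (bigD1 (ordS i)) //= eqxx mul1r big1 ?addr0 // => j /negPf ->.
by rewrite mul0r.
Qed.

Lemma transf_mx_scale (R : realType) (n : nat) (w : 'cV[R[i]]_n) (a : R[i]) :
  transf_mx (a *: w) = 1%:M + a *: (transf_mx w - 1%:M).
Proof. by apply/matrixP => i j; rewrite !mxE [j == i]eq_sym; ring. Qed.

Lemma transf_mx_const (R : realType) (n : nat) (w : 'cV[R[i]]_n) :
  transf_mx w *m const_mx 1 = const_mx 1 :> 'cV_n.
Proof. by apply/colP => i; rewrite transf_mx_mul !mxE; ring. Qed.

Lemma transf_mx_weights_of (R : realType) (n : nat) (v : 'cV[R[i]]_n) :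
  (forall i, v (ordS i) 0 != v i 0) ->
  transf_mx (weights_of v) *m v = 2 *: v.
Proof.
move=> hv; apply/colP => i; rewrite transf_mx_mul !mxE.
by have := hv i; rewrite -subr_eq0 => hi; field.
Qed.

Theorem theorem2 (R : realType) (n : nat) (hn : (3 <= n)%N) (v : 'cV[R[i]]_n)
    (hv : forall i : 'I_n, v (ordS i) 0 != v i 0) :
  let Mt := transf_mx (weights_of v) in
  [/\ eigenvector Mt 2 v,
      eigenvector Mt 1 (const_mx 1),
      exists mu : nat -> R[i], remaining_eigenvalues Mt mu &
      forall mu : nat -> R[i], remaining_eigenvalues Mt mu ->
        \bigcap_(i in [set i | (2 <= i < n)%N]) Lambda (mu i) !=set0 ->
        exists w : 'cV[R[i]]_n, limit_polygon (transf_mx w) v].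
Proof.
case: n hn v hv => // n hn v hv /=.
set A := transf_mx _.
have Av : A *m v = 2 *: v := transf_mx_weights_of _ _ _ hv.
have Au : A *m const_mx 1 = (const_mx 1 : 'cV_n.+1) := transf_mx_const _ _ _.
have u0 : (const_mx 1 : 'cV[R[i]]_n.+1) != 0.
  by apply/eqP => /colP/(_ 0) /eqP; rewrite !mxE oner_eq0.
have v0 : v != 0.
  by apply/eqP => v0; have := hv 0; rewrite v0 !mxE eqxx.
split; [by split | by split; rewrite // scale1r | |].
  have : ('X - 2%:P) * ('X - 1%:P) %| char_poly A.
    apply: (char_poly_eigen2_dvd _ _ _ _ _ _ (const_mx 1) Av _ v0) => [|c].
      by rewrite scale1r.
    (* A constant polygon [c *: v] has [c != 0], so two consecutive vertices of [v] would
       coincide. *)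
    apply/eqP => /colP uE; have := hv 0.
    have := uE 0; have := uE (ordS 0); rewrite !mxE => e1 e2.
    have c0 : c != 0.
      by apply: contraTneq (oner_neq0 R[i]) => c0; rewrite e1 c0 mul0r eqxx.
    by rewrite -(inj_eq (mulfI c0)) -e1 -e2 eqxx.
  move=> /dvdpP [q pE].
  have [s qs] := closed_field_poly_normal q.
  have p12 : ('X - 2%:P) * ('X - 1%:P) \is @monic R[i].
    by rewrite monicMl monicXsubC.
  have q1 : lead_coef q = 1.
    by have := char_poly_monic A; rewrite pE monicMr // => /monicP.
  move: qs; rewrite q1 scale1r => qs.
  (* The degree count makes the roots of [q] match the indices from 2 on, whence the shift by 2 in
     the witness below. *)
  have ss : size s = (n.+1 - 2)%N.
    have := size_char_poly A; rewrite pE size_Mmonic //; last first.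
      by rewrite -lead_coef_eq0 q1 oner_eq0.
    rewrite qs size_prod_XsubC.
    rewrite size_Mmonic ?polyXsubC_eq0 ?monicXsubC // !size_XsubC /=.
    by lia.
  exists (fun i => nth 0 s (i - 2) - 1).
  rewrite /remaining_eigenvalues pE mulrC; congr (_ * _).
  rewrite qs (big_nth 0) ss -{2}[2%N]add0n big_addn.
  by apply: eq_bigr => i _; rewrite addnK [1 + _]addrC subrK.
move=> mu pA [lam hlam]; exists (lam *: weights_of v).
rewrite transf_mx_scale.
have lamP i : (2 <= i < n.+1)%N -> `|1 + lam * mu i| < `|1 + lam|.
  by move=> /hlam; rewrite /Lambda /= ltr_pXn2r ?nnegrE.
apply: (limit_polygon_dominant _ _ _ _ _
  [seq 1 + mu i | i <- index_iota 2 n.+1]) => //.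
(* The index 2 exists because there are at least three vertices; its strict inequality forces
   [1 + lam != 0]. *)
- rewrite -normr_gt0; apply: le_lt_trans (lamP 2%N _) => //.
- by rewrite big_map.
- move=> x /seq.mapP[j]; rewrite mem_index_iota => /lamP hj ->.
  by rewrite [1 + mu j]addrC addrK.
Qed.
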